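(* For every connected bipartite graph $G$ which is not isomorphic to $K_2$, the multigraph $^2G$ satisfies ${\rm lir}(^2G)\le 2$.
   Context: For a graph $G$, $^2G$ denotes the multigraph obtained from $G$ by replacing every edge by two parallel edges. The degree of a vertex in a multigraph counts parallel edges with multiplicity. A multigraph is locally irregular if any two adjacent vertices have distinct degrees. A locally irregular edge coloring of a multigraph $M$ is an assignment of colors to the individual edges of $M$ (the two parallel copies of an edge may receive different colors) such that, for each color, the submultigraph formed by the edges of that color is locally irregular. ${\rm lir}(M)$ is the smallest number of colors in a locally irregular edge coloring of $M$. *)

(* Defs.v *)
From mathcomp Require Import all_boot.

Set Implicit Arguments.
Unset Strict Implicit.
Unset Printing Implicit Defensive.

Record sgraph := SGraph {
  svertex :> finType;
  sedge : rel svertex;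
  sedge_sym : symmetric sedge;
  sedge_irrefl : irreflexive sedge }.

Definition sgraph_iso (G H : sgraph) : Prop :=
  exists2 f : G -> H, bijective f & {mono f : x y / sedge x y}.

Definition connected (G : sgraph) : Prop :=
  0 < #|G| /\ forall x y : G, connect (@sedge G) x y.

Definition bipartite (G : sgraph) : Prop :=
  exists A : {set G}, forall x y : G, sedge x y -> (x \in A) != (y \in A).

Fact complete_sym n : symmetric (fun i j : 'I_n => i != j).
Proof. by move=> i j; rewrite eq_sym. Qed.

Fact complete_irrefl n : irreflexive (fun i j : 'I_n => i != j).
Proof. by move=> i; rewrite eqxx. Qed.

Definition complete_graph (n : nat) : sgraph :=
  SGraph (@complete_sym n) (@complete_irrefl n).

Definition edge_set (G : sgraph) : {set {set G}} :=
  [set e | [exists x, exists y, sedge x y && (e == [set x; y])]].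

(* Loopless multigraphs: edges are individual objects, so parallel edges are
   distinct elements of [medge] with the same set of endpoints. *)
Record mgraph := MGraph {
  mvertex : finType;
  medge : finType;
  mends : medge -> {set mvertex};
  mends_card : forall e, #|mends e| = 2 }.

Definition madj (M : mgraph) (x y : mvertex M) : Prop :=
  exists e : medge M, x != y /\ mends e = [set x; y].

Definition mdeg (M : mgraph) (x : mvertex M) : nat :=
  #|[set e : medge M | x \in mends e]|.

Definition locally_irregular (M : mgraph) : Prop :=
  forall x y : mvertex M, madj x y -> mdeg x <> mdeg y.

Definition edge_sub (M : mgraph) (F : {set medge M}) : mgraph :=
  @MGraph (mvertex M) {e : medge M | e \in F}
    (fun e => mends (val e)) (fun e => mends_card (val e)).

Definition locally_irregular_coloring (M : mgraph) (k : nat)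
    (c : medge M -> 'I_k) : Prop :=
  forall i : 'I_k, locally_irregular (edge_sub [set e | c e == i]).

Definition lir_colorable (M : mgraph) (k : nat) : Prop :=
  exists c : medge M -> 'I_k, locally_irregular_coloring c.

(* [is_lir M k] reads "lir(M) = k"; lir is a relation because some multigraphs
   (e.g. two parallel edges) have no locally irregular edge coloring. *)
Definition is_lir (M : mgraph) (k : nat) : Prop :=
  lir_colorable M k /\ forall j : nat, lir_colorable M j -> k <= j.

(* lir(M) <= n, including that lir(M) is defined. *)
Definition lir_le (M : mgraph) (n : nat) : Prop :=
  exists2 k : nat, is_lir M k & k <= n.

Fact edge_set_card (G : sgraph) (e : {set G}) : e \in edge_set G -> #|e| = 2.
Proof.
rewrite inE => /existsP [x /existsP [y /andP [xy /eqP ->]]].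
rewrite cards2; case: eqVneq xy => // ->.
by rewrite sedge_irrefl.
Qed.

(* The boolean tells apart the two parallel copies of an edge. *)
Definition double_graph (G : sgraph) : mgraph :=
  @MGraph (svertex G) ({e : {set G} | e \in edge_set G} * bool)%type
    (fun e => val e.1) (fun e => edge_set_card (valP e.1)).

(* Main.v *)
(* Encode a 2-coloring of the doubled edges by the number r(xy) of red copies
   of each edge xy.  The edges with r = 1 alone determine the parity of the red
   degrees, and the blue degrees have the same parity.  So if a side A of the
   bipartition has even size, a T-join J with T = A, taken as the set of edges
   with r = 1, makes both degrees odd on A and even off A.

   If both sides are odd, let C be a smallest nonempty vertex set attached to
   the rest of G by a single vertex w; then no vertex of C is a cut vertex.
   For v in C, say in A, take J in G - v with T = A - v.  Conflicts can only
   occur between v and its neighbors, whose degrees are adjusted by choosing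
   r = 0 or r = 2 on the edges outside J.  Making the edges from v to K red and
   the other edges at v blue works unless some neighbor u of v has degree
   2|K| - 1 (u in K) or 2(deg v - |K|) - 1 (u not in K).  For v of maximal
   degree in C, either K = N(v) or K = N(v) - w avoids this, or v can be
   replaced by a neighbor u in C with K = N(u). *)

Require Import Defs.
From mathcomp Require Import all_boot zify.
From Stdlib Require Import Classical.

Set Implicit Arguments.
Unset Strict Implicit.
Unset Printing Implicit Defensive.

(** * Colorings of the doubled edges as weights 0, 1, 2 on the edges *)

Lemma lir_leI (M : mgraph) (n : nat) : lir_colorable M n -> lir_le M n.
Proof.
elim/ltn_ind: n => n IHn Mn.
have [[j [ltjn Mj]]|noj] := classic (exists j, j < n /\ lir_colorable M j).
  have [k Mk lekj] := IHn j ltjn Mj.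
  by exists k; last exact: leq_trans lekj (ltnW _).
exists n => //; split=> // j Mj; rewrite leqNgt; apply/negP => ltjn.
by apply: noj; exists j.
Qed.

Definition nbhd (G : sgraph) (x : G) : {set G} := [set y | sedge x y].

Lemma mem_edge_set (G : sgraph) (x y : G) :
  ([set x; y] \in edge_set G) = sedge x y.
Proof.
rewrite inE; apply/existsP/idP => [[a /existsP[b]]|xy]; last first.
  by exists x; apply/existsP; exists y; rewrite xy eqxx.
case/andP=> ab /eqP eqs.
have neab : a != b by apply: contraTneq ab => ->; rewrite sedge_irrefl.
move/setP: eqs => eqs.
have := eqs a; have := eqs b; have := eqs x; have := eqs y.
rewrite !inE !eqxx ?orbT /=.
case/esym/orP => /eqP->; case/esym/orP => /eqP->; rewrite ?eqxx //.
- by rewrite eq_sym (negPf neab).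
- by rewrite sedge_sym.
- by move=> _; rewrite (negPf neab).
Qed.

Lemma sum_edges_at (G : sgraph) (x : G) (F : {set G} -> nat) :
  \sum_(s in edge_set G | x \in s) F s = \sum_(y in nbhd x) F [set x; y].
Proof.
rewrite -(big_imset F (h := fun y => [set x; y])) /=; last first.
  move=> y z; rewrite !inE => xy xz /setP eqs.
  have := eqs y; rewrite !inE eqxx orbT => /esym/orP[/eqP yx|/eqP //].
  by rewrite yx sedge_irrefl in xy.
apply: eq_bigl => s; apply/andP/imsetP => [[se xs]|[y xy ->]]; last first.
  by move: xy; rewrite mem_edge_set !inE eqxx.
move: (se); rewrite inE => /existsP[a /existsP[b /andP[ab /eqP eqs]]].
move: xs; rewrite eqs !inE => /orP[]/eqP ->; first by exists b; rewrite ?inE.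
by exists a; rewrite ?inE 1?sedge_sym // setUC.
Qed.

(** Describing [F] by a predicate [P] on arbitrary vertex sets lets the sum range over neighbors
    without carrying proofs that [[set x; y]] is an edge. *)
Lemma mdeg_double (G : sgraph) (F : {set medge (double_graph G)})
    (P : {set G} -> bool -> bool) (x : G) :
  (forall e, (e \in F) = P (val e.1) e.2) ->
  @mdeg (edge_sub F) x =
    \sum_(y in nbhd x) (P [set x; y] true + P [set x; y] false).
Proof.
move=> FP; rewrite -(sum_edges_at x (fun s => P s true + P s false)).
rewrite /mdeg -sum1_card /=.
under eq_bigl do rewrite inE /=.
rewrite -(big_sub_cond (mem F) (fun e => x \in val e.1) (fun=> 1)) /=.
rewrite (big_sub_cond (mem (edge_set G)) (fun s : {set G} => x \in s)
  (fun s => P s true + P s false)) /=.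
transitivity (\sum_(s : {e : {set G} | e \in edge_set G} | x \in val s)
   \sum_(b : bool | true) P (val s) b).
  rewrite pair_big_dep /= big_mkcondl /=.
  by apply: eq_big => [e|e _]; rewrite ?andbT // FP; case: (P _ _).
by apply: eq_bigr => s _; rewrite big_bool.
Qed.

(** [r x y] counts the red copies of xy, [2 - r x y] the blue ones. A color that xy does not carry
    imposes nothing on xy, hence the guards [0 < r x y] and [r x y < 2]. *)
Lemma weights_colorable (G : sgraph) (r : G -> G -> nat) :
    (forall x y, sedge x y -> r x y = r y x) -> (forall x y, r x y <= 2) ->
    (forall x y, sedge x y -> 0 < r x y ->
      \sum_(z in nbhd x) r x z <> \sum_(z in nbhd y) r y z) ->
    (forall x y, sedge x y -> r x y < 2 ->
      \sum_(z in nbhd x) (2 - r x z) <> \sum_(z in nbhd y) (2 - r y z)) ->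
  lir_colorable (double_graph G) 2.
Proof.
move=> rC r2 red blue.
(* Edges are unordered: [rho] picks either ordering, which is harmless by [rC]; 0 is a dummy value
   off the edges. *)
pose rho (s : {set G}) :=
  if [pick p : G * G | sedge p.1 p.2 && (s == [set p.1; p.2])] is Some p
  then r p.1 p.2 else 0.
have rhoE x y : sedge x y -> rho [set x; y] = r x y.
  move=> xy; rewrite /rho; case: pickP; last first.
    by move/(_ (x, y)); rewrite /= xy eqxx.
  move=> [a b] /= /andP[ab /eqP eqs].
  have neab : a != b by apply: contraTneq ab => ->; rewrite sedge_irrefl.
  move/setP: eqs => eqs; have := eqs a; have := eqs b.
  rewrite !inE !eqxx ?orbT.
  case/orP => /eqP ?; case/orP => /eqP ?; subst => //.
  - by rewrite eqxx in neab.
  - by rewrite rC.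
  - by rewrite eqxx in neab.
(* Copy [true] is red from weight 1 on, copy [false] only at weight 2. Color 0 is red. *)
pose red_copy s (b : bool) := if b then 0 < rho s else 1 < rho s.
pose c (e : medge (double_graph G)) : 'I_2 := inord (~~ red_copy (val e.1) e.2).
have cE e i : (c e == i) = (red_copy (val e.1) e.2 == (val i == 0)).
  rewrite -val_eqE /= inordK; last by case: (red_copy _ _).
  by case: i => [[|[|i]]] ?; case: (red_copy _ _).
exists c => i x y [[e ei]] /= [nexy exy].
have eE : val e.1 = [set x; y] :> {set G} := exy.
have xy : sedge x y by rewrite -mem_edge_set -eE; apply: (valP e.1).
have dE z := @mdeg_double G [set e | c e == i]
  (fun s b => red_copy s b == (val i == 0)) z.
rewrite !dE => [|? | ?]; rewrite ?inE //.
move: ei; rewrite inE cE eE /red_copy rhoE // => ei.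
case: (val i == 0) ei => ei.
  have sumE z : \sum_(y0 in nbhd z) ((red_copy [set z; y0] true == true) +
    (red_copy [set z; y0] false == true)) = \sum_(t in nbhd z) r z t.
    apply: eq_bigr => t; rewrite inE => zt; rewrite /red_copy rhoE //.
    by case: (r z t) (r2 z t) => [|[|[|]]].
  rewrite !sumE; apply: red => //.
  by case: e.2 ei => /eqP //; apply: leq_trans.
have sumE z : \sum_(y0 in nbhd z) ((red_copy [set z; y0] true == false) +
  (red_copy [set z; y0] false == false)) = \sum_(t in nbhd z) (2 - r z t).
  apply: eq_bigr => t; rewrite inE => zt; rewrite /red_copy rhoE //.
  by case: (r z t) (r2 z t) => [|[|[|]]].
rewrite !sumE; apply: blue => //.
by case: e.2 ei; case: (r x y) => [|[|]].
Qed.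

(** * Parity of weighted degrees and T-joins *)

Lemma odd_weight_sum (G : sgraph) (J : rel G) (r : G -> G -> nat) (x : G) :
    (forall y, J x y -> sedge x y) ->
    (forall y, sedge x y -> odd (r x y) = J x y) ->
  odd (\sum_(y in nbhd x) r x y) = \big[addb/false]_y J x y.
Proof.
move=> Je rJ; rewrite (big_morph odd oddD erefl) big_mkcond /=.
apply: eq_bigr => y _; rewrite inE; case: ifP => [/rJ //|].
by case: (boolP (J x y)) => // /Je ->.
Qed.

(** Add modulo 2 the edges of one walk from [w] to each vertex of [S]. Inner vertices of a walk
    cancel, and so do the contributions of the common start [w], because |S| is even. *)
Lemma T_join (T : finType) (e : rel T) (w : T) (S : {set T}) :
    symmetric e -> {in S, forall x, connect e w x} -> ~~ odd #|S| ->
  exists J : rel T, [/\ symmetric J, subrel J e &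
    forall x, \big[addb/false]_y J x y = (x \in S)].
Proof.
move=> eC conS evenS.
pose realized (p : T -> bool) := exists J : rel T, [/\ symmetric J, subrel J e &
  forall x, \big[addb/false]_y J x y = p x].
have realized_ext p q : p =1 q -> realized p -> realized q.
  by move=> pq [J [JC Je Jp]]; exists J; split=> // x; rewrite Jp pq.
have realized0 : realized xpred0.
  by exists (fun _ _ => false); split=> // x; rewrite big1_eq.
have realizedD p q :
    realized p -> realized q -> realized (fun x => p x (+) q x).
  move=> [J [JC Je Jp]] [K [KC Ke Kq]]; exists (fun x y => J x y (+) K x y).
  split=> [x y|x y|x]; first by rewrite JC KC.
    by have := Je x y; have := Ke x y; case: (J x y); case: (K x y) => // _ ->.
  by rewrite big_split /= Jp Kq.
have realized_edge a b : e a b -> realized (fun x => (x == a) (+) (x == b)).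
  move=> ab; exists (fun x y => (x == a) && (y == b) (+) (x == b) && (y == a)).
  split=> [x y|x y|x].
  - by rewrite addbC andbC [(x == a) && _]andbC.
  - case: (boolP ((x == a) && (y == b))) => [/andP[/eqP-> /eqP->] _|_] //.
    by case/andP => /eqP-> /eqP->; rewrite eC.
  have sum1 d (q : bool) : \big[addb/false]_y (q && (y == d)) = q.
    rewrite (bigD1 d) //= eqxx andbT big1 ?addbF // => y /negPf ->.
    by rewrite andbF.
  by rewrite big_split /= !sum1.
have realized_pair x :
    connect e w x -> realized (fun z => (z == w) (+) (z == x)).
  case/connectP => p; elim: p w {conS} => [|y p IHp] a /=.
    by move=> _ ->; apply: realized_ext realized0 => z; rewrite addbb.
  case/andP=> ay yp xE.
  apply: realized_ext (realizedD _ _ (realized_edge _ _ ay) (IHp _ yp xE)) => z.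
  by rewrite addbA addbK.
have realized_seq s : {subset s <= S} ->
    realized (fun z => \big[addb/false]_(x <- s) ((z == w) (+) (z == x))).
  elim: s => [|x s IHs] sS.
    by apply: realized_ext realized0 => z; rewrite big_nil.
  have xw : connect e w x by apply/conS/sS/mem_head.
  have {}IHs := IHs (fun y ys => sS y (mem_behead (s := x :: s) ys)).
  apply: realized_ext (realizedD _ _ (realized_pair x xw) IHs) => z.
  by rewrite big_cons.
have enumS : {subset enum S <= S} by move=> x; rewrite mem_enum.
apply: realized_ext (realized_seq _ enumS) => z.
have -> : \big[addb/false]_(x <- enum S) ((z == w) (+) (z == x)) =
    \big[addb/false]_(x in S) ((z == w) (+) (z == x)) by rewrite big_enum.
have iterE n b : iter n (addb b) false = odd n && b.
  by elim: n => //= n ->; case: b (odd n) => [] [].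
rewrite big_split /= big_const iterE (negPf evenS) addFb.
have [zS|zS] := boolP (z \in S).
  rewrite (bigD1 z) //= eqxx big1 // => x /andP[_ /negPf].
  by rewrite eq_sym.
by rewrite big1 // => x xS; apply: contraNF zS => /eqP ->.
Qed.

(** * Colorings built from T-joins *)

Lemma even_part_colorable (G : sgraph) (A : {set G}) :
    connected G -> (forall x y : G, sedge x y -> (x \in A) != (y \in A)) ->
    ~~ odd #|A| ->
  lir_colorable (double_graph G) 2.
Proof.
move=> [/card_gt0P[w _] conG] bip evenA.
have [J [JC Je JA]] := T_join (@sedge_sym G) (fun x _ => conG w x) evenA.
have parity (r : G -> G -> nat) (rJ : forall x y, odd (r x y) = J x y) x :
    odd (\sum_(y in nbhd x) r x y) = (x \in A).
  by rewrite (@odd_weight_sum _ J) ?JA // => y; apply: Je.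
have redJ x y : odd (J x y) = J x y by rewrite oddb.
have blueJ x y : odd (2 - J x y) = J x y by case: (J x y).
apply: (@weights_colorable _ (fun x y => J x y)) => [x y _|x y|x y xy _|x y xy _].
- by rewrite JC.
- by case: (J x y).
- move/(congr1 odd); rewrite !(parity (fun x y => J x y)) // => ?.
  by have := bip x y xy; apply/negP/negPn/eqP.
- move/(congr1 odd); rewrite !(parity (fun x y => 2 - J x y)) // => ?.
  by have := bip x y xy; apply/negP/negPn/eqP.
Qed.

Lemma sum_if_const (T : finType) (B : {set T}) (P : pred T) (a b : nat) :
  \sum_(y in B) (if P y then a else b) =
    #|[set y in B | P y]| * a + #|[set y in B | ~~ P y]| * b.
Proof.
rewrite (bigID P) /=; congr (_ + _).
  rewrite -sum_nat_const; apply: eq_big => [y|y /andP[_ ->]] //; by rewrite inE.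
rewrite -sum_nat_const.
by apply: eq_big => [y|y /andP[_ /negPf ->]] //; rewrite inE.
Qed.

(** Parity separates the ends of every edge of G - v, so a neighbor u only has to avoid the degree
    of v in the color of uv. Let j be the degree of u in [J]. Coloring the remaining edges at u all
    red or all blue offers the degrees j + 2 and 2 deg u - j in that color. Both are bad only if
    they coincide, that is deg u = j + 1, and then deg u + 1 is the degree of v, which [redK] and
    [blueK] exclude. *)
Lemma odd_part_colorable (G : sgraph) (A : {set G}) (v w : G) (K : {set G}) :
    (forall x y : G, sedge x y -> (x \in A) != (y \in A)) ->
    odd #|A| -> v \in A -> K \subset nbhd v ->
    (forall x, x != v ->
      connect (fun x y => [&& sedge x y, x != v & y != v]) w x) ->
    {in K, forall u, #|nbhd u|.+1 <> 2 * #|K|} ->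
    {in nbhd v :\: K, forall u, #|nbhd u|.+1 <> 2 * #|nbhd v :\: K|} ->
  lir_colorable (double_graph G) 2.
Proof.
move=> bip oddA vA sKv conGv redK blueK.
have edgeC : symmetric (fun x y : G => [&& sedge x y, x != v & y != v]).
  by move=> x y /=; rewrite sedge_sym [(x != v) && _]andbC.
have [J [JC Je JA]] : exists J : rel G, [/\ symmetric J,
    subrel J (fun x y => [&& sedge x y, x != v & y != v]) &
    forall x, \big[addb/false]_y J x y = (x \in A :\ v)].
  apply: (T_join (w := w)) => // [x|].
    by rewrite !inE => /andP[xv _]; apply: conGv.
  by move: oddA; rewrite (cardsD1 v) vA.
have Jv y : J v y = false by apply/negP => /Je /and3P[_]; rewrite eqxx.
pose j u := #|[set y in nbhd u :\ v | J u y]|.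
(* r = 2 f u on the edges outside J from a neighbor u of v to G - v. *)
pose f u := if u \in K then (j u).+2 == 2 * #|K|
            else (j u).+2 != 2 * #|nbhd v :\: K|.
(* [f] is read at the end outside [A], where all neighbors of v lie. No two of them are adjacent, so
   their choices do not interfere. *)
pose r x y : nat := if x == v then 2 * (y \in K) else
  if y == v then 2 * (x \in K) else
  if J x y then 1 else 2 * (if x \in A then f y else f x).
have r2 x y : r x y <= 2 by rewrite /r; do ![case: ifP => ? //]; lia.
have oddr x y : odd (r x y) = J x y.
  rewrite /r; case: eqP => [->|_]; first by rewrite Jv oddM.
  case: eqP => [->|_]; first by rewrite JC Jv oddM.
  by case: ifP => // _; rewrite oddM.
have oddr' x y : odd (2 - r x y) = J x y by rewrite oddB // oddr.
have rC x y : sedge x y -> r x y = r y x.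
  move=> /bip xy; rewrite /r JC.
  case: eqP => [->|_]; first by case: eqP => [->|]; rewrite ?eqxx.
  case: ifP => // _; case: ifP => // _.
  by move: xy; case: (x \in A); case: (y \in A).
have parity (q : G -> G -> nat) x : (forall x y, odd (q x y) = J x y) ->
    odd (\sum_(y in nbhd x) q x y) = (x \in A :\ v).
  by move=> qJ; rewrite (@odd_weight_sum _ J) ?JA // => y /Je /and3P[].
have same_parity x y : sedge x y ->
    (x \in A :\ v) = (y \in A :\ v) -> x = v \/ y = v.
  move=> /bip; rewrite !inE; case: (x =P v); case: (y =P v); auto.
  by case: (x \in A); case: (y \in A).
have red_v : \sum_(y in nbhd v) r v y = 2 * #|K|.
  rewrite -sum1_card big_distrr /= (big_setID K) /= (setIidPr sKv).
  rewrite [X in _ + X]big1 ?addn0 => [|y]; last first.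
    by rewrite !inE /r eqxx => /andP[/negPf->].
  by apply: eq_bigr => y yK; rewrite /r eqxx yK.
have blue_v : \sum_(y in nbhd v) (2 - r v y) = 2 * #|nbhd v :\: K|.
  rewrite -sum1_card big_distrr /= (big_setID K) /= (setIidPr sKv).
  rewrite big1 ?add0n => [|y yK]; last by rewrite /r eqxx yK.
  by apply: eq_bigr => y; rewrite !inE /r eqxx => /andP[/negPf->].
(* [g] is the identity for red degrees and [subn 2] for blue ones. The summands come from uv, from
   [J] and from the remaining edges; [j u < #|nbhd u|] keeps the subtraction exact. *)
have sum_nbr (g : nat -> nat) u : sedge u v ->
    \sum_(y in nbhd u) g (r u y) =
      g (2 * (u \in K)) + j u * g 1 + (#|nbhd u| - (j u).+1) * g (2 * f u)
    /\ j u < #|nbhd u|.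
  move=> uv; have vu : v \in nbhd u by rewrite inE.
  have uA : u \notin A by have := bip _ _ uv; rewrite vA; case: (u \in A).
  have uDv : u == v = false by apply: contraNF uA => /eqP ->.
  have cardE : j u + #|[set y in nbhd u :\ v | ~~ J u y]| = #|nbhd u :\ v|.
    rewrite -[RHS](cardsID [set y | J u y]); congr (_ + _); apply: eq_card => y;
    by rewrite !inE // andbC.
  have cardN : #|nbhd u| = (#|nbhd u :\ v|).+1.
    by rewrite (cardsD1 v (nbhd u)) vu.
  have -> : #|nbhd u| - (j u).+1 = #|[set y in nbhd u :\ v | ~~ J u y]| by lia.
  split; last by lia.
  rewrite (big_setD1 v) //= -addnA -sum_if_const {1}/r uDv eqxx; congr (_ + _).
  apply: eq_bigr => y; rewrite !inE => /andP[/negPf yDv _].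
  by rewrite /r uDv yDv (negPf uA); case: ifP.
have red_nbr u : sedge v u -> 0 < r v u ->
    \sum_(y in nbhd u) r u y <> \sum_(y in nbhd v) r v y.
  rewrite sedge_sym => uv; rewrite {1}/r eqxx red_v.
  have [-> ltj] := sum_nbr id u uv; case: (boolP (u \in K)) => // uK _.
  by have := redK u uK; rewrite /f uK; case: eqP => /=; lia.
have blue_nbr u : sedge v u -> r v u < 2 ->
    \sum_(y in nbhd u) (2 - r u y) <> \sum_(y in nbhd v) (2 - r v y).
  move=> vu; have uv : sedge u v by rewrite sedge_sym.
  rewrite {1}/r eqxx blue_v.
  have [-> ltj] := sum_nbr (subn 2) u uv; case: (boolP (u \in K)) => // uK _.
  have := blueK u; rewrite !inE uK vu => /(_ isT).
  by rewrite /f (negPf uK); case: eqP => /=; lia.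
apply: (@weights_colorable _ r) => // x y xy rxy eqxy.
  have := congr1 odd eqxy; rewrite !(parity r) //.
  move=> /(same_parity _ _ xy)[] ?; subst.
    by apply: (red_nbr y).
  by apply: (red_nbr x); rewrite 1?sedge_sym 1?rC // sedge_sym.
have := congr1 odd eqxy; rewrite !(parity (fun x y => 2 - r x y)) //.
move=> /(same_parity _ _ xy)[] ?; subst; first by apply: (blue_nbr y).
by apply: (blue_nbr x); rewrite 1?sedge_sym 1?rC // sedge_sym.
Qed.

(** * Components hanging on a single vertex *)

Lemma closed_mem (G : sgraph) (D : {set G}) (x y : G) :
    connected G -> x \in D -> (forall z t, z \in D -> sedge z t -> t \in D) ->
  y \in D.
Proof.
move=> [_ conG] xD clD; rewrite -(closed_connect _ (conG x y)) //.
apply: intro_closed => [|z t zt zD]; first exact/sym_connect_sym/sedge_sym.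
exact: clD zt.
Qed.

(** Take [C] of minimum size. If some v in [C] separated vertices from [w], the set [D] of these
    would hang on v alone. [D] inside [C] contradicts minimality, as v is in [C] but not in [D];
    otherwise D - C is nonempty and closed under adjacency, hence contains [w], which is absurd. *)
Lemma end_component (G : sgraph) :
    connected G -> 1 < #|G| ->
  exists w : G, exists C : {set G}, [/\ w \notin C, C != set0,
    (forall x y, x \in C -> sedge x y -> y \in w |: C) &
    forall v, v \in C -> forall x, x != v ->
      connect (fun x y => [&& sedge x y, x != v & y != v]) w x].
Proof.
move=> conG G_gt1; have [/card_gt0P[w0 _] _] := conG.
pose cand (p : G * {set G}) := [&& p.1 \notin p.2, p.2 != set0 &
  [forall x in p.2, forall y, sedge x y ==> (y \in p.1 |: p.2)]].
have cand0 : cand (w0, [set~ w0]).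
  rewrite /cand /= !inE eqxx -card_gt0 cardsC1.
  rewrite -ltnS prednK ?(ltnW G_gt1) // G_gt1.
  by apply/'forall_implyP => x _; apply/forallP => y; rewrite !inE orbN implybT.
case: (arg_minnP (fun p : G * {set G} => #|p.2|) cand0) => -[w C].
move=> /and3P[/= wC C0 clC] minC.
have {}clC x y : x \in C -> sedge x y -> y \in w |: C.
  by move=> xC; move/forall_inP/(_ x xC)/forallP/(_ y)/implyP: clC.
exists w, C; split=> // v vC x xv.
pose e x y := [&& sedge x y, x != v & y != v].
apply/negPn/negP => Nwx.
pose D := [set y | y != v & ~~ connect e w y].
have clD y z : y \in D -> sedge y z -> z \in v |: D.
  rewrite !inE => /andP[yv Nwy] yz; case: eqP => //= /eqP zv.
  apply: contra Nwy => wz; apply: connect_trans wz (connect1 _).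
  by rewrite /e sedge_sym yz zv.
have wD : w \notin D by rewrite inE connect0 andbF.
have [/subsetP sDC|/subsetPn[y yD yC]] := boolP (D \subset C).
  have := minC (v, D); rewrite /= leqNgt => /(_ _)/negP; apply.
    apply/and3P; split=> /=; first by rewrite inE eqxx.
      by apply/set0Pn; exists x; rewrite inE xv.
    by apply/forall_inP => y yD; apply/forallP => z; apply/implyP; apply: clD.
  apply/proper_card/properP; split; first by apply/subsetP.
  by exists v => //; rewrite inE eqxx.
(* An edge leaving D - C would enter [C] from a vertex of [D] other than [w], or end at v, which is
   in [C]. *)
have: w \in D :\: C; last by rewrite inE (negPf wD) andbF.
apply: (closed_mem (x := y)) => [//||z t]; first by rewrite inE yC.
rewrite !in_setD => /andP[zC zD] zt.
have tC : t \notin C.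
  apply/negP => tC; have tz : sedge t z by rewrite sedge_sym.
  have := clC t z tC tz; rewrite in_setU1 (negPf zC) orbF => /eqP zw.
  by rewrite -zw zD in wD.
have := clD z t zD zt; rewrite in_setU1 tC => /predU1P[tv|//].
by rewrite tv vC in tC.
Qed.

(** * The excluded graph K_2, and the choice of v and K *)

Lemma iso_K2 (G : sgraph) (x y : G) :
    connected G -> sedge x y -> #|nbhd x| = 1 -> #|nbhd y| = 1 ->
  sgraph_iso G (complete_graph 2).
Proof.
move=> conG xy dx dy.
have nbhd1 (u v : G) :
    sedge u v -> #|nbhd u| = 1 -> forall z, sedge u z = (z == v).
  move=> uv /eqP/cards1P[t nut] z; move/setP: nut => nut.
  by have := nut z; have := nut v; rewrite !inE uv => /esym/eqP ->.
have Nx := nbhd1 x y xy dx; have Ny := nbhd1 y x (etrans (sedge_sym _ _) xy) dy.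
have all_xy z : (z == x) || (z == y).
  rewrite -in_set2; apply: (closed_mem (x := x)) => // [|a b].
    by rewrite !inE eqxx.
  by rewrite !inE => /orP[]/eqP ->; rewrite ?Nx ?Ny => ->; rewrite ?orbT.
have neyx : y == x = false.
  by apply: contraTF xy => /eqP ->; rewrite sedge_irrefl.
pose f z : 'I_2 := if z == x then ord0 else ord_max.
exists (f : G -> complete_graph 2).
  exists (fun i : 'I_2 => if i == ord0 then x else y) => [z|i]; rewrite /f.
    by case/orP: (all_xy z) => /eqP ->; rewrite ?eqxx // neyx.
  by case: i => [[|[|]]] // ?; apply: val_inj; rewrite /= ?eqxx ?neyx.
move=> a b; rewrite /f /=.
by case/orP: (all_xy a) => /eqP ->; case/orP: (all_xy b) => /eqP ->;
  rewrite ?Nx ?Ny ?eqxx ?neyx // eq_sym neyx.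
Qed.

Theorem theorem4 (G : sgraph) :
  connected G -> bipartite G -> ~ sgraph_iso G (complete_graph 2) ->
  lir_le (double_graph G) 2.
Proof.
move=> conG [A bip] notK2; apply: lir_leI.
have [oddA|] := boolP (odd #|A|); last exact: even_part_colorable bip.
have bipC x y : sedge x y -> (x \in ~: A) != (y \in ~: A).
  by move/bip; rewrite !inE; case: (x \in A); case: (y \in A).
have [oddA'|] := boolP (odd #|~: A|); last exact: even_part_colorable bipC.
have G_gt1 : 1 < #|G| by rewrite -(cardsC A); lia.
have deg_gt1 (x y : G) : sedge x y -> #|nbhd x| = 1 -> #|nbhd y| <> 1.
  by move=> xy dx dy; apply: notK2; exact: (iso_K2 conG xy).
have [w [C [wC /set0Pn[v0 v0C] clC noncut]]] := end_component conG G_gt1.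
have colorable v (K : {set G}) : v \in C -> K \subset nbhd v ->
    {in K, forall u, #|nbhd u|.+1 <> 2 * #|K|} ->
    {in nbhd v :\: K, forall u, #|nbhd u|.+1 <> 2 * #|nbhd v :\: K|} ->
    lir_colorable (double_graph G) 2.
  move=> vC sKv redK blueK; have conv := noncut v vC.
  have [vA|vA] := boolP (v \in A); first exact: (@odd_part_colorable _ A v w K).
  by apply: (@odd_part_colorable _ (~: A) v w K); rewrite ?inE.
have colorable_all v : v \in C ->
    {in nbhd v, forall u, #|nbhd u|.+1 <> 2 * #|nbhd v|} ->
    lir_colorable (double_graph G) 2.
  by move=> vC redv; apply: (colorable v (nbhd v)) => // u; rewrite setDv inE.
case: (arg_maxnP (fun v => #|nbhd v|) v0C) => v vC maxv.
have leC u : u \in C -> #|nbhd u| <= #|nbhd v| := maxv u.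
have deg_v u : u \in nbhd v -> u != w -> u \in C.
  rewrite inE => /(clC _ _ vC); rewrite !inE => /predU1P[->|//].
  by rewrite eqxx.
have deg_gt0 (x y : G) : sedge x y -> 0 < #|nbhd x|.
  by move=> xy; apply/card_gt0P; exists y; rewrite inE.
(* Write d = deg v. A neighbor u in [C] has deg u <= d, so deg u = 2d - 1 forces d = deg u = 1 and G
   is K_2. Thus K = N(v) can fail only because of [w]. *)
have [/andP[wv dw]|wv] :=
  boolP ((w \in nbhd v) && (#|nbhd w|.+1 == 2 * #|nbhd v|)); last first.
  apply: (colorable_all v) => // u uv du.
  have vu : sedge v u by rewrite inE in uv.
  have [uw|uw] := eqVneq u w; first by move: wv; rewrite -uw uv du eqxx.
  have := leC u (deg_v u uv uw); have := deg_gt1 v u vu; have := deg_gt0 v u vu.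
  lia.
move/eqP: dw => dw; have vw : sedge v w by rewrite inE in wv.
have d_gt1 : 1 < #|nbhd v|.
  by have := deg_gt0 v w vw; have := deg_gt1 v w vw; lia.
have cardK : #|nbhd v| = #|nbhd v :\ w|.+1 by rewrite (cardsD1 w (nbhd v)) wv.
(* Now deg w = 2d - 1. If K = N(v) - w fails at u, then deg u = 2d - 3 and v is replaced by u. *)
have [/existsP[u /andP[]]|noK] :=
    boolP [exists u in nbhd v :\ w, #|nbhd u|.+1 == 2 * #|nbhd v :\ w|].
  rewrite in_setD1 => /andP[uw uv] /eqP du.
  have uC := deg_v u uv uw; have vu : sedge v u by rewrite inE in uv.
  apply: (colorable_all u) => // z; rewrite inE => uz dz.
  have zw : z != w.
    apply: contraTneq uz => ->; apply/negP => /bip.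
    move: (bip _ _ vu) (bip _ _ vw).
    by case: (u \in A); case: (v \in A); case: (w \in A).
  have zC : z \in C.
    by have := clC u z uC uz; rewrite !inE (negPf zw).
  (* A bad z has deg z = 2(2d - 3) - 1 <= d, so d = 2 and both u and z are leaves. *)
  have du1 : #|nbhd u| = 1.
    by move: (leC z zC); clear -du dz cardK; lia.
  by apply: (deg_gt1 u z uz du1); clear -dz du1; lia.
apply: (colorable v (nbhd v :\ w)) => //; first exact: subsetDl.
  by move=> u uv du; case/existsP: noK; exists u; rewrite uv du eqxx.
(* Only vw is blue at v, and deg w = 2d - 1 differs from 1 because d > 1. *)
have -> : nbhd v :\: (nbhd v :\ w) = [set w].
  by apply/setP => u; rewrite !inE; case: eqVneq => [->|]; rewrite ?vw ?andNb.
by move=> u /set1P ->; rewrite cards1; lia.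
Qed.
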